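(* Let $A\subseteq\mathbb{R}$ be a nonempty compact set and let $\mathcal L_A=(\ell_j)_j$ be the associated fractal string. Then, for any $\varepsilon>0$, $$V(A_\varepsilon\setminus A)=2\int_0^\varepsilon\beta_0(A;t)\,dt=2\varepsilon+2\int_0^\varepsilon N_{\mathcal L_A}\!\left(\tfrac1{2t}\right)dt,$$ where $N_{\mathcal L_A}$ is the geometric counting function of $\mathcal L_A$.
   Context: $V$ is Lebesgue measure on $\mathbb{R}$ and $A_\varepsilon=\{x\in\mathbb{R}:\mathrm{dist}(x,A)\le\varepsilon\}$. The fractal string $\mathcal L_A=(\ell_j)$ of a nonempty compact $A\subset\mathbb{R}$ is the (finite or infinite) non-increasing sequence of lengths of the bounded connected components (open intervals) of $\mathbb{R}\setminus A$, each length repeated according to the number of such intervals having that length. Its geometric counting function is $N_{\mathcal L_A}(x)=\#\{j:\ell_j^{-1}\le x\}$, $x>0$. Let $\partial^+A$ be the set of endpoints of the connected components of $\mathbb{R}\setminus A$, and $N(A)=\{(x,n):x\in\partial^+A,\ n\in\{+1,-1\},\ x+n s\notin A \text{ for all } s\in(0,\eta]\text{ for some }\eta>0\}$. The local reach at $(x,n)\in N(A)$ is $\delta(A,x,n)=\sup\{t\ge0: x\text{ is the unique nearest point of }A\text{ to }x+tn\}\in(0,\infty]$. The support measure $\mu_0(A;\cdot)$ is $\tfrac12$ times the counting measure on $N(A)$, and the basic function of $A$ is $\beta_0(A;t)=\int_{N(A)}\mathbf 1\{t<\delta(A,x,n)\}\,\mu_0(A;d(x,n))=\tfrac12\#\{(x,n)\in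 N(A):\delta(A,x,n)>t\}$, $t>0$. *)

(* Defs.v *)
From mathcomp Require Import all_boot all_order all_algebra.
From mathcomp Require Import all_classical all_reals all_analysis.
Set Implicit Arguments.
Unset Strict Implicit.
Unset Printing Implicit Defensive.
Import Order.TTheory GRing.Theory Num.Theory.
Import numFieldNormedType.Exports.
Local Open Scope classical_set_scope.
Local Open Scope card_scope.
Local Open Scope ring_scope.

Definition dist (R : realType) (x : R) (A : set R) : R :=
  inf [set `|x - a| | a in A].

Definition parallel_set (R : realType) (A : set R) (eps : R) : set R :=
  [set x | dist x A <= eps].

Definition components (R : realType) (B : set R) : set (set R) :=
  [set connected_component B x | x in B].

(* The components of ~` A are open intervals when A is closed. *)
Definition gaps (R : realType) (A : set R) : set (set R) :=
  [set I | components (~` A) I /\ bounded_set I].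

Definition ilength (R : realType) (I : set R) : R := sup I - inf I.

(* A finite or infinite sequence of reals: [len] is meaningful only on the
   index set [idx], an initial segment of nat, see [is_fractal_string]. *)
Record rstring (R : realType) := RString {
  idx : set nat;
  len : nat -> R }.

(* [L] is the fractal string of [A]: a non-increasing sequence taking each
   value r exactly as often as there are gaps of A of length r. *)
Definition is_fractal_string (R : realType) (A : set R) (L : rstring R) : Prop :=
  [/\ forall i j : nat, (i <= j)%N -> idx L j -> idx L i,
      forall i j : nat, (i <= j)%N -> idx L j -> len L j <= len L i
    & forall r : R, [set j | idx L j /\ len L j = r]
                    #= [set I | gaps A I /\ ilength I = r] ].

Definition geom_counting (R : realType) (L : rstring R) (x : R) : \bar R :=
  counting [set j | idx L j /\ (len L j)^-1 <= x].

Definition endpoint (R : realType) (I : set R) (x : R) : Prop :=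
  (has_lbound I /\ x = inf I) \/ (has_ubound I /\ x = sup I).

Definition pboundary (R : realType) (A : set R) : set R :=
  [set x | exists2 I, components (~` A) I & endpoint I x].

Definition normal_bundle (R : realType) (A : set R) : set (R * R) :=
  [set xn | [/\ pboundary A xn.1, xn.2 = 1 \/ xn.2 = -1 &
     exists2 eta : R, 0 < eta &
       forall s, 0 < s <= eta -> ~ A (xn.1 + xn.2 * s)] ].

Definition nearest_points (R : realType) (A : set R) (y : R) : set R :=
  [set a | A a /\ `|y - a| = dist y A].

Definition local_reach (R : realType) (A : set R) (xn : R * R) : \bar R :=
  ereal_sup [set t%:E | t in
    [set t : R | 0 <= t /\ nearest_points A (xn.1 + t * xn.2) = [set xn.1]]].

Definition support_measure0 (R : realType) (A : set R) (S : set (R * R)) :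
    \bar R :=
  ((2^-1)%:E * counting (normal_bundle A `&` S))%E.

(* The integral over the normal bundle of the indicator of t < local_reach,
   i.e. the support measure of the corresponding set. *)
Definition beta0 (R : realType) (A : set R) (t : R) : \bar R :=
  support_measure0 A [set xn | (t%:E < local_reach A xn)%E].

(* Main.v *)
(** Each bounded gap ]a, b[ of A, of length l, meets the eps-neighbourhood of A
in measure 2 min(eps, l/2), and carries exactly two normals, (a, 1) and (b, -1),
both of reach l/2; the two unbounded components contribute eps each and carry
one normal of infinite reach each.  Since both {t in ]0, eps] : 2t < l} and
{t in ]0, eps] : 2t <= l} have measure min(eps, l/2), the three quantities all
equal 2 eps + 2 sum_j min(eps, l_j/2), by countable additivity and by exchanging
sum and integral. *)
Require Import Defs.
From mathcomp Require Import all_boot all_order all_algebra.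
From mathcomp Require Import all_classical all_reals all_analysis.
From mathcomp Require Import measurable_realfun lra.
Set Implicit Arguments.
Unset Strict Implicit.
Import Order.TTheory GRing.Theory Num.Theory.
Import numFieldNormedType.Exports.
Local Open Scope classical_set_scope.
Local Open Scope ring_scope.

(** * Compact subsets of the line, their gaps and the components of the complement *)

Lemma compact_min (R : realType) (K : set R) : K !=set0 -> compact K ->
  exists2 m, K m & lbound K m.
Proof.
move=> K0 cK; have [|c /set_mem Kc cmin] := compact_EVT_min (f := idfun) K0 cK.
  by apply: continuous_subspaceT => x; exact: cvg_id.
by exists c => // x Kx; apply: cmin; rewrite inE.
Qed.

Lemma compact_max (R : realType) (K : set R) : K !=set0 -> compact K ->
  exists2 m, K m & ubound K m.
Proof.
move=> K0 cK; have [|c /set_mem Kc cmax] := compact_EVT_max (f := idfun) K0 cK.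
  by apply: continuous_subspaceT => x; exact: cvg_id.
by exists c => // x Kx; apply: cmax; rewrite inE.
Qed.

(** A bounded component is handled through its two endpoints. That they lie in [A] is what makes
    []a, b[] maximal among the intervals avoiding [A]. *)
Definition is_gap (R : realType) (A : set R) (a b : R) : Prop :=
  [/\ a < b, A a, A b & forall z, a < z < b -> ~ A z].

(** For [y] between [m] and [M], the gap around [y] runs from the largest point of [A] below [y] to
    the smallest one above; compactness provides both. *)
Lemma notin_compact (R : realType) (A : set R) (m M y : R) : compact A ->
  A m -> A M -> ~ A y ->
  [\/ y < m, M < y | exists a b, is_gap A a b /\ a < y < b].
Proof.
move=> cA Am AM nAy.
have [ym|my] := ltP y m; first by constructor 1.
have [My|yM] := ltP M y; first by constructor 2.
have [||a [Aa /= ay] amax] := @compact_max _ (A `&` `]-oo, y]).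
- by exists m; split; rewrite //= in_itv.
- by apply: compact_closedI => //; exact: interval_closed.
have [||b [Ab /= yb] bmin] := @compact_min _ (A `&` `[y, +oo[).
- by exists M; split; rewrite //= in_itv /= andbT.
- by apply: compact_closedI => //; exact: interval_closed.
rewrite !in_itv /= ?andbT in ay yb.
have {}ay : a < y by rewrite lt_neqAle ay andbT; apply: contra_notN nAy => /eqP <-.
have {}yb : y < b by rewrite lt_neqAle yb andbT; apply: contra_notN nAy => /eqP ->.
constructor 3; exists a, b; split; last by rewrite ay.
split=> //; first exact: lt_trans yb.
move=> z /andP[az zb] Az; have [zy|yz] := leP z y.
  by move: (amax z); rewrite /= in_itv /= => /(_ (conj Az zy)); rewrite leNgt az.
move: (bmin z); rewrite /= in_itv /= andbT => /(_ (conj Az (ltW yz))).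
by rewrite leNgt zb.
Qed.

(** On the line connected sets are intervals, so a component is the largest interval through [y]
    inside [B]. *)
Lemma connected_component_itv (R : realType) (B I : set R) (y : R) :
  is_interval I -> I y -> I `<=` B ->
  (forall J, is_interval J -> J y -> J `<=` B -> J `<=` I) ->
  connected_component B y = I.
Proof.
move=> iI Iy IB Imax; apply/seteqP; split.
  apply: Imax; last exact: connected_component_sub.
    by apply/connected_intervalP; exact: component_connected.
  by apply: connected_component_refl; exact: IB.
by apply: connected_component_max => //; apply/connected_intervalP.
Qed.

Lemma component_gap (R : realType) (A : set R) (a b y : R) : is_gap A a b ->
  a < y < b -> connected_component (~` A) y = `]a, b[%classic.
Proof.
move=> [ab Aa Ab gA] /andP[ay yb].
apply: connected_component_itv.
- exact: interval_is_interval.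
- by rewrite /= in_itv /= ay.
- by move=> z /=; rewrite in_itv; exact: gA.
move=> J iJ Jy JA z Jz; rewrite /= in_itv /=; apply/andP; split.
  rewrite ltNge; apply/negP => za; apply: (JA a) => //.
  by apply: (iJ z y) => //; rewrite za ltW.
rewrite ltNge; apply/negP => bz; apply: (JA b) => //.
by apply: (iJ y z) => //; rewrite bz ltW.
Qed.

Lemma component_above (R : realType) (A : set R) (M y : R) : A M ->
  ubound A M -> M < y -> connected_component (~` A) y = `]M, +oo[%classic.
Proof.
move=> AM uM My; apply: connected_component_itv.
- exact: interval_is_interval.
- by rewrite /= in_itv /= My.
- by move=> z /=; rewrite in_itv /= andbT => Mz /uM; rewrite leNgt Mz.
move=> J iJ Jy JA z Jz; rewrite /= in_itv /= andbT ltNge; apply/negP => zM.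
by apply: (JA M) => //; apply: (iJ z y) => //; rewrite zM ltW.
Qed.

Lemma component_below (R : realType) (A : set R) (m y : R) : A m ->
  lbound A m -> y < m -> connected_component (~` A) y = `]-oo, m[%classic.
Proof.
move=> Am lm ym; apply: connected_component_itv.
- exact: interval_is_interval.
- by rewrite /= in_itv /= ym.
- by move=> z /=; rewrite in_itv /= => zm /lm; rewrite leNgt zm.
move=> J iJ Jy JA z Jz; rewrite /= in_itv /= ltNge; apply/negP => mz.
by apply: (JA m) => //; apply: (iJ y z) => //; rewrite mz ltW.
Qed.

Lemma is_gap_component (R : realType) (A : set R) (a b : R) : is_gap A a b ->
  components (~` A) `]a, b[%classic.
Proof.
move=> gab; have [ab _ _ gA] := gab.
have mid : a < (a + b) / 2 < b by rewrite !midf_lt.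
by exists ((a + b) / 2); [exact: gA | exact: component_gap].
Qed.

Lemma componentsP (R : realType) (A I : set R) (m M : R) : compact A ->
  A m -> lbound A m -> A M -> ubound A M ->
  components (~` A) I <->
  [\/ I = `]-oo, m[%classic, I = `]M, +oo[%classic |
      exists a b, is_gap A a b /\ I = `]a, b[%classic].
Proof.
move=> cA Am lm AM uM; split.
  move=> [y nAy <-]; have [ym|My|[a [b [gab yab]]]] := notin_compact cA Am AM nAy.
  - by constructor 1; exact: component_below.
  - by constructor 2; exact: component_above.
  - by constructor 3; exists a, b; split => //; exact: component_gap.
move=> [->|->|[a [b [gab ->]]]]; last exact: is_gap_component.
- have mm : m - 1 < m by lra.
  exists (m - 1); last exact: component_below.
  by move=> /lm; rewrite leNgt mm.
- have MM : M < M + 1 by lra.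
  exists (M + 1); last exact: component_above.
  by move=> /uM; rewrite leNgt MM.
Qed.

(** If two gaps share a point but differ at an end, then an endpoint of one, which is a point of
    [A], lies strictly inside the other. *)
Lemma is_gap_eq (R : realType) (A : set R) (a b a' b' y : R) :
  is_gap A a b -> is_gap A a' b' -> a < y < b -> a' < y < b' ->
  a = a' /\ b = b'.
Proof.
move=> [_ Aa Ab g] [_ Aa' Ab' g'] /andP[ay yb] /andP[a'y yb'].
have [na na' nb nb'] : [/\ ~~ (a' < a), ~~ (a < a'), ~~ (b < b') & ~~ (b' < b)].
  split; apply/negP => h.
  - by apply: (g' a) => //; rewrite h (lt_trans ay).
  - by apply: (g a') => //; rewrite h (lt_trans a'y).
  - by apply: (g' b) => //; rewrite h (lt_trans _ yb).
  - by apply: (g b') => //; rewrite h (lt_trans _ yb').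
by split; apply/eqP; rewrite eq_le !leNgt ?na ?na' ?nb ?nb'.
Qed.

(** The midpoint of [a] and the smaller of [b], [b'] lies in both gaps, which therefore coincide. *)
Lemma is_gap_left_inj (R : realType) (A : set R) (a b b' : R) :
  is_gap A a b -> is_gap A a b' -> b = b'.
Proof.
move=> gab gab'; have [ab _ _ _] := gab; have [ab' _ _ _] := gab'.
have mid : a < (a + Num.min b b') / 2 < Num.min b b'.
  by rewrite !midf_lt // lt_min ab.
have [amid] := andP mid; rewrite lt_min => /andP[mb mb'].
by have [] := is_gap_eq (y := (a + Num.min b b') / 2) gab gab'; rewrite ?amid.
Qed.

Lemma is_gap_right_inj (R : realType) (A : set R) (a a' b : R) :
  is_gap A a b -> is_gap A a' b -> a = a'.
Proof.
move=> gab gab'; have [ab _ _ _] := gab; have [ab' _ _ _] := gab'.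
have mid : Num.max a a' < (Num.max a a' + b) / 2 < b.
  by rewrite !midf_lt // gt_max ab.
have [+ bmid] := andP mid; rewrite gt_max => /andP[ma ma'].
by have [] := is_gap_eq (y := (Num.max a a' + b) / 2) gab gab'; rewrite ?ma ?ma'.
Qed.

Lemma gapsP (R : realType) (A I : set R) : A !=set0 -> compact A ->
  gaps A I <-> exists a b, is_gap A a b /\ I = `]a, b[%classic.
Proof.
move=> A0 cA; have [m Am lm] := compact_min A0 cA.
have [M AM uM] := compact_max A0 cA; split.
  move=> [/(componentsP _ cA Am lm AM uM)[->|->|//] [K [_ KI]]].
    have K1 : K < `|K| + 1 by rewrite (le_lt_trans (ler_norm _))// ltrDl.
    (* A point of the ray below [m] whose absolute value exceeds the supposed bound [|K| + 1]; the
       ray above [M] is refuted symmetrically. *)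
    have := KI _ K1 (- (`|K| + `|m| + 2)); rewrite /= in_itv /=.
    have := lerNnormlW (lexx `|m|).
    have := normr_ge0 K; have := normr_ge0 m => h1 h2 h3.
    rewrite normrN (@ger0_norm _ (`|K| + `|m| + 2)); last by lra.
    by move=> h; exfalso; have := h ltac:(lra); lra.
  have K1 : K < `|K| + 1 by rewrite (le_lt_trans (ler_norm _))// ltrDl.
  have := KI _ K1 (`|K| + `|M| + 2); rewrite /= in_itv /= andbT.
  have := ler_norm M.
  have := normr_ge0 K; have := normr_ge0 M => h1 h2 h3.
  rewrite (@ger0_norm _ (`|K| + `|M| + 2)); last by lra.
  by move=> h; exfalso; have := h ltac:(lra); lra.
move=> [a [b [gab ->]]]; split; first exact: is_gap_component.
exists (Num.max `|a| `|b|); split; first exact: num_real.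
move=> x; rewrite gt_max => /andP[ax bx] y /=; rewrite in_itv /= => /andP[ay yb].
move: ax bx; rewrite !ltr_norml => /andP[? ?] /andP[? ?].
by rewrite ler_norml; apply/andP; split; lra.
Qed.

Lemma ilength_itvoo (R : realType) (a b : R) : a < b ->
  ilength `]a, b[%classic = b - a.
Proof. by move=> ab; rewrite /ilength sup_itv ?inf_itv ?bnd_simp. Qed.

(* The equinumerosities for the individual lengths r glue to a bijection from
   the indices of the string onto the gaps, j being sent by the bijection
   chosen for r = len L j. *)
Lemma fractal_string_gaps (R : realType) (A : set R) (L : rstring R) :
  A !=set0 -> compact A -> is_fractal_string A L ->
  exists a b : nat -> R,
  [/\ forall j, idx L j -> is_gap A (a j) (b j),
      forall j, idx L j -> b j - a j = len L j,
      forall i j, idx L i -> idx L j -> a i = a j -> i = j &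
      forall x y, is_gap A x y -> exists2 j, idx L j & a j = x /\ b j = y].
Proof.
move=> A0 cA [_ _ Lcard].
have /choice[f fP] : forall r, exists f : nat -> set R,
    set_bij [set j | idx L j /\ len L j = r] [set I | gaps A I /\ ilength I = r] f.
  by move=> r; exact/card_set_bijP.
pose g j := f (len L j) j.
have gP j : idx L j -> gaps A (g j) /\ ilength (g j) = len L j.
  by move=> Lj; have [+ _ _] := fP (len L j); apply.
have ginj i j : idx L i -> idx L j -> g i = g j -> i = j.
  move=> Li Lj gij; have [_ leni] := gP i Li; have [_ lenj] := gP j Lj.
  (* Equal gaps have equal lengths, so both indices are governed by the same bijection, whose
     injectivity applies. *)
  have lenij : len L i = len L j by rewrite -leni -lenj gij.
  have [_ inj _] := fP (len L i).
  by apply: inj; rewrite ?inE //= -/(g i) gij /g lenij.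
have gitv j : idx L j ->
    is_gap A (inf (g j)) (sup (g j)) /\ g j = `]inf (g j), sup (g j)[%classic.
  move=> Lj; have [/(gapsP _ A0 cA)[a [b [gab ->]]] _] := gP j Lj.
  by have [ab _ _ _] := gab; rewrite sup_itv ?inf_itv ?bnd_simp.
exists (fun j => inf (g j)), (fun j => sup (g j)); split.
- by move=> j /gitv[].
- by move=> j /gP[_ <-].
- move=> i j Li Lj ij; apply: ginj => //.
  have [gi ->] := gitv i Li; have [gj ->] := gitv j Lj.
  by move: gi; rewrite ij => gi; rewrite (is_gap_left_inj gi gj).
- move=> x y gxy; have [xy _ _ _] := gxy.
  have [_ _ surj] := fP (y - x).
  have [|j [Lj lenj] fj] := surj `]x, y[%classic.
    split; last exact: ilength_itvoo.
    by apply/(gapsP _ A0 cA); exists x, y.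
  exists j => //; have -> : g j = `]x, y[%classic by rewrite /g lenj.
  by rewrite sup_itv ?inf_itv ?bnd_simp.
Qed.

(** * The unit normals of a compact set *)

(** If [(x, n)] is a normal, then [x + n * eta] lies outside [A] and no point of [A] separates it
    from [x]; hence [x] is an endpoint of the component containing that point, on the side fixed by
    the sign of [n]. *)
Lemma normal_bundleP (R : realType) (A : set R) (m M : R) (xn : R * R) :
  compact A -> A m -> lbound A m -> A M -> ubound A M ->
  normal_bundle A xn <->
  xn = (M, 1) \/ (exists b, is_gap A xn.1 b /\ xn.2 = 1) \/
  xn = (m, -1) \/ (exists a, is_gap A a xn.1 /\ xn.2 = -1).
Proof.
move=> cA Am lm AM uM; case: xn => x n /=; split; last first.
  have endl a b : is_gap A a b -> pboundary A a.
    move=> gab; exists `]a, b[%classic; first exact: is_gap_component.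
    have [ab _ _ _] := gab.
    left; split; last by rewrite inf_itv ?bnd_simp.
    by exists a => z /=; rewrite in_itv /= => /andP[/ltW].
  have endr a b : is_gap A a b -> pboundary A b.
    move=> gab; exists `]a, b[%classic; first exact: is_gap_component.
    have [ab _ _ _] := gab.
    right; split; last by rewrite sup_itv ?bnd_simp.
    by exists b => z /=; rewrite in_itv /= => /andP[_ /ltW].
  have compP := componentsP _ cA Am lm AM uM.
  case=> [[-> ->]|[[b [gab ->]]|[[-> ->]|[a [gab ->]]]]]; split => /=; auto.
  - exists `]M, +oo[%classic; first by apply/compP; constructor 2.
    left; split; last by rewrite inf_itv ?bnd_simp.
    by exists M => z /=; rewrite in_itv /= andbT => /ltW.
  - exists 1 => // s /andP[s0 _] /uM; lra.
  - exact: endl gab.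
  - have [ab _ _ gA] := gab; exists ((b - x) / 2); first by lra.
    by move=> s /andP[s0 s1]; apply: gA; apply/andP; split; lra.
  - exists `]-oo, m[%classic; first by apply/compP; constructor 1.
    right; split; last by rewrite sup_itv ?bnd_simp.
    by exists m => z /=; rewrite in_itv /= => /ltW.
  - exists 1 => // s /andP[s0 _] /lm; lra.
  - exact: endr gab.
  - have [ab _ _ gA] := gab; exists ((x - a) / 2); first by lra.
    by move=> s /andP[s0 s1]; apply: gA; apply/andP; split; lra.
move=> [/= bx n1 [eta eta0 etaA]].
have Ax : A x.
  have [I /(componentsP _ cA Am lm AM uM) + e] := bx.
  case=> [|| [a [b [[ab Aa Ab _] ]]]] IE; move: e;
      rewrite IE => -[[[z zI] ->]|[[z zI] ->]] //.
  (* The ray below [m] has no lower bound: this point belongs to it and lies below the supposed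
     bound [z]. Thus only the finite ends of the rays count as endpoints, and they are in [A]. *)
  - exfalso; have := zI (Num.min m z - 1); rewrite /= in_itv /=.
    by case: (leP m z) => h1 h3; have := h3 ltac:(lra); lra.
  - by rewrite sup_itv ?bnd_simp.
  - by rewrite inf_itv ?bnd_simp.
  - exfalso; have := zI (Num.max M z + 1); rewrite /= in_itv /= andbT.
    by case: (leP M z) => h1 h3; have := h3 ltac:(lra); lra.
  - by rewrite inf_itv ?bnd_simp.
  - by rewrite sup_itv ?bnd_simp.
have nAy : ~ A (x + n * eta) by apply: etaA; rewrite eta0 lexx.
have [xm xM] := (lm _ Ax, uM _ Ax).
case: n1 => n1; rewrite n1 ?mul1r ?mulN1r in etaA nAy *.
(* No point of [A] lies in []x, x + eta]], so points of [A] to the right of [x] are beyond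
   [x + eta]. This forces [x] to be [M] or the left end of the gap around [x + eta]. *)
- have nAs z : A z -> x < z -> x + eta < z.
    move=> Az xz; rewrite ltNge; apply/negP => zx.
    apply: (etaA (z - x)); first by apply/andP; split; lra.
    by rewrite mul1r addrC subrK.
  have [?|Mx|[a [b [gab /andP[ax xb]]]]] := notin_compact cA Am AM nAy.
  + by exfalso; lra.
  + left; congr pair; apply/eqP; rewrite eq_le xM leNgt; apply/negP => h.
    by have := nAs _ AM h; lra.
  + right; left; exists b; split => //; suff -> : x = a by [].
    have [_ Aa _ gA] := gab; apply/eqP; rewrite eq_le !leNgt.
    apply/andP; split; apply/negP => h; last by have := nAs _ Aa h; lra.
    by apply: (gA x) => //; apply/andP; split; lra.
- have nAs z : A z -> z < x -> z < x - eta.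
    move=> Az xz; rewrite ltNge; apply/negP => zx.
    apply: (etaA (x - z)); first by apply/andP; split; lra.
    by rewrite mulN1r subKr.
  have [mx|?|[a [b [gab /andP[ax xb]]]]] := notin_compact cA Am AM nAy.
  + right; right; left; congr pair; apply/eqP; rewrite eq_le xm andbT leNgt.
    by apply/negP => h; have := nAs _ Am h; lra.
  + by exfalso; lra.
  + right; right; right; exists a; split => //; suff -> : x = b by [].
    have [_ _ Ab gA] := gab; apply/eqP; rewrite eq_le !leNgt.
    apply/andP; split; apply/negP => h; first by have := nAs _ Ab h; lra.
    by apply: (gA x) => //; apply/andP; split; lra.
Qed.

(** * Distance, nearest points and local reach *)

(** By compactness the infimum defining [dist] is attained, so the bound is realised by an actual
    point of [A]. *)
Lemma dist_leP (R : realType) (A : set R) (y e : R) :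
  A !=set0 -> compact A -> dist y A <= e <-> exists2 a, A a & `|y - a| <= e.
Proof.
move=> A0 cA.
have lb : has_lbound [set `|y - a| | a in A] by exists 0 => _ [a _ <-].
split=> [ye|[a Aa ya]]; last first.
  by apply: le_trans ya; apply: ge_inf => //; exists a.
have [|c /set_mem Ac cmin] := compact_EVT_min (f := fun a => `|y - a|) A0 cA.
  apply: continuous_subspaceT => x.
  by apply: cvg_norm; apply: cvgB; [exact: cvg_cst | exact: cvg_id].
exists c => //; apply: le_trans ye; apply: lb_le_inf; first by exists `|y - c|, c.
by move=> _ [a Aa <-]; apply: cmin; rewrite inE.
Qed.

(** Removes the infimum from the notion of unique nearest point; the reach is then found by
    comparing distances pairwise. *)
Lemma nearest_points_eq1 (R : realType) (A : set R) (x y : R) : A x ->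
  nearest_points A y = [set x] <->
  forall a, A a -> a <> x -> `|y - x| < `|y - a|.
Proof.
move=> Ax.
have lb : has_lbound [set `|y - a| | a in A] by exists 0 => _ [a _ <-].
split=> [nx a Aa ax|nx].
  have [_ dx] : nearest_points A y x by rewrite nx.
  rewrite lt_neqAle dx ge_inf ?andbT; [|by []|by exists a].
  by apply/eqP => da; apply: ax; have : nearest_points A y a by []; rewrite nx.
have dx : `|y - x| = dist y A.
  apply/eqP; rewrite eq_le; apply/andP; split; last by apply: ge_inf => //; exists x.
  apply: lb_le_inf; first by exists `|y - x|, x.
  move=> _ [a Aa <-]; have [->//|/eqP ax] := eqVneq a x.
  exact: ltW (nx _ Aa ax).
apply/seteqP; split=> [a [Aa da]|_ ->] //=.
by apply: contrapT => /(nx _ Aa); rewrite da dx ltxx.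
Qed.

Lemma lt_local_reach (R : realType) (A : set R) (x n t : R) :
  (t%:E < local_reach A (x, n))%E <->
  exists s, [/\ 0 <= s, nearest_points A (x + s * n) = [set x] & t < s].
Proof.
split=> [/ereal_sup_gtP[_ [s [s0 sn] <-]] ts|[s [s0 sn ts]]].
  by exists s; split.
by apply/ereal_sup_gtP; exists s%:E => //; exists s.
Qed.

Lemma local_reach_max (R : realType) (A : set R) (M t : R) : 0 < t ->
  A M -> ubound A M -> (t%:E < local_reach A (M, 1%R))%E.
Proof.
move=> t0 AM uM; apply/lt_local_reach; exists (t + 1); split; [lra| |lra].
apply/(nearest_points_eq1 _ AM) => a /[dup] Aa /uM aM /eqP aNM.
have {aNM}aM : a < M by rewrite lt_neqAle aNM.
by rewrite !ger0_norm; lra.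
Qed.

Lemma local_reach_min (R : realType) (A : set R) (m t : R) : 0 < t ->
  A m -> lbound A m -> (t%:E < local_reach A (m, (-1)%R))%E.
Proof.
move=> t0 Am lm; apply/lt_local_reach; exists (t + 1); split; [lra| |lra].
apply/(nearest_points_eq1 _ Am) => a /[dup] Aa /lm ma /eqP aNm.
have {aNm}ma : m < a by rewrite lt_neqAle eq_sym aNm.
by rewrite !ler0_norm; lra.
Qed.

(** Moving from [a] into the gap, the only serious competitor of [a] is [b], and it stays strictly
    farther away exactly up to the midpoint. *)
Lemma local_reach_left (R : realType) (A : set R) (a b t : R) : 0 < t ->
  is_gap A a b -> (t%:E < local_reach A (a, 1%R))%E <-> 2 * t < b - a.
Proof.
move=> t0 [ab Aa Ab gA]; split.
  move=> /lt_local_reach[s [s0 /(nearest_points_eq1 _ Aa)/(_ b Ab) + ts]].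
  move=> /(_ ltac:(lra)); rewrite (_ : a + s * 1 - a = s); last by lra.
  rewrite ger0_norm //; case: (ler0P (a + s * 1 - b)); lra.
move=> tab; apply/lt_local_reach.
(* The mean of [t] and the half-length: it exceeds [t] and still falls short of the midpoint of the
   gap. *)
exists ((t + (b - a) / 2) / 2); split; [lra| |lra].
apply/(nearest_points_eq1 _ Aa) => c Ac /eqP ca.
have [ltca|ltac|/eqP] := ltgtP c a; last by rewrite (negbTE ca).
  by rewrite !ger0_norm; lra.
have bc : b <= c by rewrite leNgt; apply/negP => cb; apply: (gA c); rewrite // ltac.
by rewrite ger0_norm ?ler0_norm; lra.
Qed.

Lemma local_reach_right (R : realType) (A : set R) (a b t : R) : 0 < t ->
  is_gap A a b -> (t%:E < local_reach A (b, (-1)%R))%E <-> 2 * t < b - a.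
Proof.
move=> t0 [ab Aa Ab gA]; split.
  move=> /lt_local_reach[s [s0 /(nearest_points_eq1 _ Ab)/(_ a Aa) + ts]].
  move=> /(_ ltac:(lra)); rewrite (_ : b + s * -1 - b = - s); last by lra.
  rewrite normrN ger0_norm //; case: (ler0P (b + s * -1 - a)); lra.
move=> tab; apply/lt_local_reach.
exists ((t + (b - a) / 2) / 2); split; [lra| |lra].
apply/(nearest_points_eq1 _ Ab) => c Ac /eqP cb.
have [ltcb|ltbc|/eqP] := ltgtP c b; last by rewrite (negbTE cb).
  have ca : c <= a by rewrite leNgt; apply/negP => ac; apply: (gA c); rewrite // ac.
  by rewrite ler0_norm ?ger0_norm; lra.
by rewrite !ler0_norm; lra.
Qed.

(** * The counting measure and integrals of counting functions *)

Lemma counting_set1 (T : choiceType) (R : realType) (x : T) :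
  counting [set x] = 1%E :> \bar R.
Proof.
rewrite /counting; case: asboolP => [_|]; last by case; exact: finite_set1.
by rewrite fset_set1 (finmap.cardfs1 x : size _ = _).
Qed.

(** Makes the additivity of [counting], viewed as a measure on the plane, available for countable
    sets of normals. *)
Lemma measurable_countable_prod (R : realType) (E : set (R * R)) : countable E ->
  measurable (E : set (measurableTypeR R * measurableTypeR R)).
Proof.
apply: countable_measurable => -[x y].
rewrite (_ : [set (x, y)] = [set x] `*` [set y]); last first.
  by apply/seteqP; split=> [_ -> //|[u v] [/= -> ->]].
by apply: measurableX; exact: measurable_set1.
Qed.

Lemma counting_set2 (R : realType) (p q : R * R) : p <> q ->
  counting [set p; q] = 2%:E :> \bar R.
Proof.
move=> pq; pose mu : {measure set (measurableTypeR R * measurableTypeR R) -> \bar R}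
  := counting.
have -> : counting [set p; q] = mu [set p; q] by [].
rewrite measureU.
- by rewrite /mu /= !counting_set1 -EFinD.
- by apply: measurable_countable_prod; exact: countable1.
- by apply: measurable_countable_prod; exact: countable1.
- by apply/seteqP; split=> // z [/= ->] /pq.
Qed.

(** Here [p0], [q0] stand for the normals of the unbounded components and [p j], [q j] for those of
    the gap [j]. The hypotheses make these pairs disjoint, and each contributes 2 by countable
    additivity. *)
Lemma counting_bigcup_set2 (R : realType) (J : set nat) (p q : nat -> R * R)
    (p0 q0 : R * R) : p0 <> q0 ->
  (forall i j, J i -> J j -> p i = p j -> i = j) ->
  (forall i j, J i -> J j -> q i = q j -> i = j) ->
  (forall i j, J i -> J j -> p i <> q j) ->
  (forall j, J j -> [/\ p j <> p0, p j <> q0, q j <> p0 & q j <> q0]) ->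
  (counting ([set p0; q0] `|` \bigcup_(j in J) [set p j; q j])
     = 2%:E + 2%:E * counting J :> \bar R)%E.
Proof.
move=> pq0 pinj qinj pq pq0J.
pose mu : {measure set (measurableTypeR R * measurableTypeR R) -> \bar R}
  := counting.
have cE j : countable [set p j; q j].
  by apply: finite_set_countable; exact: finite_set2.
have tE : trivIset J (fun j => [set p j; q j]).
  move=> i j Ji Jj [z /= [[->|->] [e|e]]].
  - exact: pinj.
  - by case: (pq i j).
  - by case: (pq j i).
  - exact: qinj.
rewrite -[LHS]/(mu _) (measureU mu).
- congr (_ + _)%E; first exact: counting_set2.
  transitivity (\sum_(0 <= j <oo | j \in J) mu [set p j; q j])%E.
    by apply: measure_bigcup => // j _; exact: measurable_countable_prod.
  (* Written as a sum of Dirac masses, [counting J] is a series of zeros and ones, to be compared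
     with the left side term by term. *)
  rewrite counting_dirac -nneseriesZl // eseries_mkcond.
  apply: eq_eseriesr => j _; rewrite diracE.
  case: ifPn => jJ; last by rewrite mule0.
  by rewrite mule1 /mu /= counting_set2 //; apply: pq; exact: set_mem.
- apply: measurable_countable_prod; apply: finite_set_countable.
  exact: finite_set2.
- apply: measurable_countable_prod; exact: bigcup_countable.
- apply/seteqP; split=> // z [/= z0 [j Jj zj]]; have [? ? ? ?] := pq0J j Jj.
  by case: z0 zj => -> [] /esym.
Qed.

(** The series form of a count depending on [t], from which measurability and the exchange of sum
    and integral follow. *)
Lemma counting_indic (R : realType) (F : nat -> set R) (t : R) :
  counting [set j | F j t] = (\sum_(0 <= j <oo) (\1_(F j) t)%:E)%E :> \bar R.
Proof.
rewrite counting_dirac; apply: eq_eseriesr => j _; rewrite diracE indicE.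
suff -> : (j \in [set i | F i t]) = (t \in F j) by [].
by apply/idP/idP => /set_mem h; apply/mem_set; exact: h.
Qed.

Lemma measurable_counting (R : realType) (D : set R) (F : nat -> set R) :
  (forall j, measurable (F j)) ->
  measurable_fun D (fun t => counting [set j | F j t] : \bar R).
Proof.
move=> mF; rewrite (funext (@counting_indic R F)).
apply: ge0_emeasurable_sum => // j _.
by apply/measurable_EFinP; apply: measurable_indic; exact: mF.
Qed.

Lemma integral_counting (R : realType) (D : set R) (F : nat -> set R) :
  measurable D -> (forall j, measurable (F j)) ->
  (\int[lebesgue_measure]_(t in D) counting [set j | F j t]
     = \sum_(0 <= j <oo) lebesgue_measure (F j `&` D))%E.
Proof.
move=> mD mF; under eq_integral => t _ do rewrite counting_indic.
rewrite integral_nneseries //.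
- by apply: eq_eseriesr => j _; apply: integral_indic => //; exact: mF.
- by move=> j; apply/measurable_EFinP; apply: measurable_indic; exact: mF.
Qed.

(** * Lengths attached to a single gap *)

(** If [e] reaches the half-length, the two end pieces cover the gap; otherwise they are disjoint
    intervals of length [e]. *)
Lemma lebesgue_measure_near_ends (R : realType) (a b e : R) : a < b -> 0 < e ->
  (lebesgue_measure (`]a, b[ `&` (`]-oo, (a + e)%R] `|` `[(b - e)%R, +oo[))
     = 2%:E * (Num.min e ((b - a) / 2))%:E)%E.
Proof.
move=> ab e0; rewrite -EFinM; have [e2|e2] := leP ((b - a) / 2) e.
  rewrite (_ : _ `&` _ = `]a, b[%classic); last first.
    apply/seteqP; split=> [x []//|x /=]; rewrite !in_itv /= andbT => /andP[ax xb].
    split; first by rewrite ax.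
    by have [|xm] := leP x (a + e); [left | right; lra].
  rewrite lebesgue_measure_itv /= lte_fin ab -EFinB; congr (_%:E); lra.
rewrite (_ : _ `&` _ = `]a, a + e]%classic `|` `[b - e, b[%classic); last first.
  apply/seteqP; split=> x /=; rewrite !in_itv /= andbT.
    by move=> [/andP[-> ->] [->|->]]; [left | right].
  by move=> [|] /andP[h1 h2]; split; [apply/andP; split; lra | left; lra |
    apply/andP; split; lra | right; lra].
rewrite measureU //; last first.
  apply/seteqP; split=> // x [] /=; rewrite !in_itv /= => /andP[_ h1] /andP[h2 _].
  lra.
have ae : a < a + e by lra.
have be : b - e < b by lra.
rewrite /= !lebesgue_measure_itv /= !lte_fin ae be -!EFinB -EFinD.
by congr (_%:E); lra.
Qed.

(** The strict inequality arises from the basic function, the large one from the geometric counting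
    function; the two sets differ at most in the null set [{l / 2}]. *)
Lemma lebesgue_measure_halved (R : realType) (l e : R) : 0 < l -> 0 < e ->
  lebesgue_measure ([set t : R | 2 * t < l] `&` `]0, e])
    = (Num.min e (l / 2))%:E /\
  lebesgue_measure ([set t : R | 2 * t <= l] `&` `]0, e])
    = (Num.min e (l / 2))%:E.
Proof.
move=> l0 e0; have [h|h] := leP (l / 2) e; split.
- rewrite (_ : _ `&` _ = `]0, l / 2[%classic); last first.
    apply/seteqP; split=> x /=; rewrite !in_itv /=.
      by move=> [h1 /andP[h2 h3]]; apply/andP; split; lra.
    by move=> /andP[h1 h2]; split; [lra | apply/andP; split; lra].
  by rewrite lebesgue_measure_itv /= lte_fin divr_gt0 // sube0.
- rewrite (_ : _ `&` _ = `]0, l / 2]%classic); last first.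
    apply/seteqP; split=> x /=; rewrite !in_itv /=.
      by move=> [h1 /andP[h2 h3]]; apply/andP; split; lra.
    by move=> /andP[h1 h2]; split; [lra | apply/andP; split; lra].
  by rewrite lebesgue_measure_itv /= lte_fin divr_gt0 // sube0.
- rewrite (_ : _ `&` _ = `]0, e]%classic); last first.
    apply/seteqP; split=> [x []//|x /=]; rewrite !in_itv /= => /andP[h1 h2].
    by split; [lra | apply/andP; split; lra].
  by rewrite lebesgue_measure_itv /= lte_fin e0 sube0.
- rewrite (_ : _ `&` _ = `]0, e]%classic); last first.
    apply/seteqP; split=> [x []//|x /=]; rewrite !in_itv /= => /andP[h1 h2].
    by split; [lra | apply/andP; split; lra].
  by rewrite lebesgue_measure_itv /= lte_fin e0 sube0.
Qed.

(** * The volume of the parallel set *)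

Lemma parallel_setD (R : realType) (A : set R) (m M e : R) : 0 < e ->
  compact A -> A m -> lbound A m -> A M -> ubound A M ->
  parallel_set A e `\` A = `[m - e, m[ `|` `]M, M + e] `|`
    \bigcup_(ab in [set ab | is_gap A ab.1 ab.2])
      (`]ab.1, ab.2[ `&` (`]-oo, ab.1 + e] `|` `[ab.2 - e, +oo[)).
Proof.
move=> e0 cA Am lm AM uM.
have A0 : A !=set0 by exists m.
apply/seteqP; split=> x.
  move=> [/(dist_leP _ _ A0 cA)[c Ac]]; rewrite ler_norml => /andP[xc1 xc2] nAx.
  have [mc cM] := (lm _ Ac, uM _ Ac).
  have [xm|Mx|[a [b [gab /andP[ax xb]]]]] := notin_compact cA Am AM nAx.
  - by left; left; rewrite /= in_itv /=; apply/andP; split; lra.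
  - by left; right; rewrite /= in_itv /=; apply/andP; split; lra.
  - right; exists (a, b) => //=; rewrite !in_itv /= andbT ax xb; split => //.
    (* The point [c] of [A] near [x] is not inside the gap, so the endpoint on its side is at least
       as close to [x]. *)
    have [_ _ _ gA] := gab; have [ca|ac] := leP c a; first by left; lra.
    right; suff : b <= c by lra.
    by rewrite leNgt; apply/negP => cb; apply: (gA c); rewrite // ac.
case=> [[|]|[[a b] /= gab]] /=; rewrite !in_itv /= ?andbT.
- move=> /andP[h1 h2]; split; last by move=> /lm; lra.
  by apply/(dist_leP _ _ A0 cA); exists m => //; rewrite ler_norml; apply/andP; split; lra.
- move=> /andP[h1 h2]; split; last by move=> /uM; lra.
  by apply/(dist_leP _ _ A0 cA); exists M => //; rewrite ler_norml; apply/andP; split; lra.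
- have [ab Aa Ab gA] := gab; move=> [axb h]; have /andP[ax xb] := axb.
  split; last exact: gA.
  apply/(dist_leP _ _ A0 cA); case: h => h.
    by exists a => //; rewrite ler_norml; apply/andP; split; lra.
  by exists b => //; rewrite ler_norml; apply/andP; split; lra.
Qed.

Lemma lebesgue_measure_parallel_setD (R : realType) (A : set R) (L : rstring R)
    (e : R) : A !=set0 -> compact A -> is_fractal_string A L -> 0 < e ->
  (lebesgue_measure (parallel_set A e `\` A) = (2 * e)%:E +
     2%:E * \sum_(0 <= j <oo | j \in idx L) (Num.min e (len L j / 2))%:E)%E.
Proof.
move=> A0 cA AL e0; have [m Am lm] := compact_min A0 cA.
have [M AM uM] := compact_max A0 cA.
have [a [b [gab ab ainj gsurj]]] := fractal_string_gaps A0 cA AL.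
have mM : m <= M := lm _ AM.
rewrite (parallel_setD e0 cA Am lm AM uM).
pose G j := `]a j, b j[%classic `&`
  (`]-oo, a j + e]%classic `|` `[b j - e, +oo[%classic).
have mG j : measurable (G j).
  by apply: measurableI => //; exact: measurableU.
(* The gaps are reindexed by the string, which turns the union into a countable one. *)
rewrite (_ : \bigcup_(ab in _) _ = \bigcup_(j in idx L) G j); last first.
  apply/seteqP; split=> x [].
    by move=> [c d] /gsurj[j Lj [<- <-]] xcd; exists j.
  by move=> j /gab gj xj; exists (a j, b j).
have tG : trivIset (idx L) G.
  move=> i j Li Lj [x [[+ _] [+ _]]]; rewrite /= !in_itv /= => xi xj.
  by apply: ainj => //; have [] := is_gap_eq (gab i Li) (gab j Lj) xi xj.
have mm : m - e < m by lra.
have MM : M < M + e by lra.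
rewrite measureU /=; last 3 first.
- exact: measurableU.
- by apply: bigcup_measurable => j _; exact: mG.
- apply/seteqP; split=> // x [xmM [j Lj [xj _]]].
  have [_ /lm ma /uM bM _] := gab j Lj.
  move: xmM xj; rewrite /= !in_itv /= => -[] /andP[? ?] /andP[? ?]; lra.
rewrite measureU //=; last first.
  apply/seteqP; split=> // x [] /=; rewrite !in_itv /= => /andP[_ ?] /andP[? _].
  lra.
rewrite !lebesgue_measure_itv /= !lte_fin mm MM -!EFinB -EFinD.
congr (_%:E + _)%E; first by lra.
transitivity (\sum_(0 <= j <oo | j \in idx L) lebesgue_measure (G j))%E.
  by apply: measure_bigcup => // j _; exact: mG.
rewrite -nneseriesZl; last first.
  move=> j /set_mem Lj; have [aj _ _ _] := gab j Lj.
  by rewrite lee_fin le_min (ltW e0) -ab // divr_ge0 // subr_ge0 ltW.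
apply: eq_eseriesr => j /set_mem Lj; have [aj _ _ _] := gab j Lj.
by rewrite -ab // /G lebesgue_measure_near_ends.
Qed.

(** * Counting functions of the string and the basic function *)

(** The relation [r] is kept general so as to serve for both [<] and [<=]. Since [idx L j] does not
    involve [t], the set is either that of [r] alone or empty. *)
Lemma measurable_string_rel (R : realType) (L : rstring R) (r : rel R) (j : nat) :
  (forall l, measurable [set t : R | r (2 * t) l]) ->
  measurable [set t : R | idx L j /\ r (2 * t) (len L j)].
Proof.
move=> mr; have [Lj|nLj] := pselect (idx L j).
  rewrite (_ : [set _ | _] = [set t | r (2 * t) (len L j)]) //.
  by apply/seteqP; split=> t //= [].
by rewrite (_ : [set _ | _] = set0) //; apply/seteqP; split=> // t [].
Qed.

Lemma integral_counting_string (R : realType) (L : rstring R) (r : rel R)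
    (D : set R) : measurable D ->
  (forall l, measurable [set t : R | r (2 * t) l]) ->
  (\int[lebesgue_measure]_(t in D) counting [set j | idx L j /\ r (2 * t)%R (len L j)]
   = \sum_(0 <= j <oo | j \in idx L)
       lebesgue_measure ([set t : R | r (2 * t)%R (len L j)] `&` D))%E.
Proof.
move=> mD mr.
rewrite (integral_counting (F := fun j => [set t | idx L j /\ r (2 * t) (len L j)])) //;
  last by move=> j; exact: measurable_string_rel.
rewrite [RHS]eseries_mkcond; apply: eq_eseriesr => j _.
case: ifPn => [/set_mem Lj|/negP nLj].
  by congr (lebesgue_measure (_ `&` _)); apply/seteqP; split=> t //= [].
rewrite (_ : [set _ | _] = set0) ?set0I ?measure0 //.
by apply/seteqP; split=> // t [/mem_set].
Qed.

(** The factor one half of the support measure cancels the two normals of each gap with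
    [2 * t < len L j]; the summand 1 comes from [(M, 1)] and [(m, -1)], whose reach is infinite. *)
Lemma beta0_counting (R : realType) (A : set R) (L : rstring R) (t : R) :
  A !=set0 -> compact A -> is_fractal_string A L -> 0 < t ->
  (beta0 A t = 1 + counting [set j | idx L j /\ (2 * t < len L j)%R])%E.
Proof.
move=> A0 cA AL t0; have [m Am lm] := compact_min A0 cA.
have [M AM uM] := compact_max A0 cA.
have [a [b [gab ab ainj gsurj]]] := fractal_string_gaps A0 cA AL.
have binj i j : idx L i -> idx L j -> b i = b j -> i = j.
  move=> Li Lj bij; apply: ainj => //; move: (gab i Li) (gab j Lj); rewrite bij.
  exact: is_gap_right_inj.
set J := [set j | _]; rewrite /beta0 /support_measure0.
have n1 : (1 : R) <> -1 by lra.
rewrite (_ : _ `&` _ = [set (M, 1); (m, -1)] `|`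
    \bigcup_(j in J) [set (a j, 1); (b j, -1)]); last first.
  apply/seteqP; split=> -[x n].
    move=> [/(normal_bundleP _ cA Am lm AM uM) /=].
    case=> [->|[[d [gd ->]]|[->|[c [gc ->]]]]]; [by left; left| |by left; right|].
    - have [j Lj [aj bj]] := gsurj _ _ gd.
      move=> /(local_reach_left t0 gd) h; right; exists j; last by left; rewrite aj.
      by split=> //; rewrite -ab // aj bj.
    - have [j Lj [aj bj]] := gsurj _ _ gc.
      move=> /(local_reach_right t0 gc) h; right; exists j; last by right; rewrite bj.
      by split=> //; rewrite -ab // aj bj.
  have nbP := normal_bundleP _ cA Am lm AM uM.
  case=> [[|] -> | [j [Lj tj] [|] ->]]; split => /=; try apply/nbP => /=.
  - by left.
  - exact: local_reach_max.
  - by right; right; left.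
  - exact: local_reach_min.
  - by right; left; exists (b j); split => //; exact: gab.
  - by apply/(local_reach_left t0 (gab j Lj)); rewrite ab.
  - by right; right; right; exists (a j); split => //; exact: gab.
  - by apply/(local_reach_right t0 (gab j Lj)); rewrite ab.
rewrite counting_bigcup_set2.
- rewrite ge0_muleDr //; last exact: mule_ge0.
  rewrite muleA -EFinM mulVf ?mul1e //; lra.
- by case=> _ /n1.
- by move=> i j [Li _] [Lj _] [/(ainj _ _ Li Lj)].
- by move=> i j [Li _] [Lj _] [/(binj _ _ Li Lj)].
- by move=> i j _ _ [_ /n1].
(* Since [m <= a j < b j <= M], the point [a j] differs from [M] and [b j] from [m]; the other pairs
   differ in direction. *)
- move=> j [Lj _]; have [aj Aa Ab _] := gab j Lj.
  have := lm _ Aa; have := uM _ Ab => bM ma.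
  by split=> -[] *; lra.
Qed.

(** * Integration over []0, eps]] and comparison of the three quantities *)

Theorem theorem8p1 (R : realType) (A : set R) (L : rstring R)
    (A_nonempty : A !=set0) (A_compact : compact A)
    (A_string : is_fractal_string A L) (eps : R) (eps_gt0 : 0 < eps) :
  (lebesgue_measure (parallel_set A eps `\` A)
     = 2%:E * \int[lebesgue_measure]_(t in `]0%R, eps]) beta0 A t)%E
  /\
  (2%:E * \int[lebesgue_measure]_(t in `]0%R, eps]) beta0 A t
     = (2 * eps)%:E
       + 2%:E * \int[lebesgue_measure]_(t in `]0%R, eps])
                  geom_counting L ((2 * t)^-1)%R)%E.
Proof.
have [a [b [gab ab _ _]]] := fractal_string_gaps A_nonempty A_compact A_string.
have len0 j : idx L j -> 0 < len L j.
  by move=> Lj; have [aj _ _ _] := gab j Lj; rewrite -ab // subr_gt0.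
(* Half of the contribution of all gaps to the volume; both integrals are expressed through it. *)
pose S := (\sum_(0 <= j <oo | j \in idx L) (Num.min eps (len L j / 2))%:E)%E.
have S0 : (0 <= S)%E.
  apply: nneseries_ge0 => j _ /set_mem Lj.
  by rewrite lee_fin le_min ltW // divr_ge0 // ltW // len0.
have mlt l : measurable [set t : R | 2 * t < l].
  rewrite (_ : [set _ | _] = `]-oo, l / 2[%classic) //.
  by apply/seteqP; split=> t /=; rewrite in_itv /=; lra.
have mle l : measurable [set t : R | 2 * t <= l].
  rewrite (_ : [set _ | _] = `]-oo, l / 2]%classic) //.
  by apply/seteqP; split=> t /=; rewrite in_itv /=; lra.
have -> : (\int[lebesgue_measure]_(t in `]0%R, eps]) beta0 A t = eps%:E + S)%E.
  transitivity (\int[lebesgue_measure]_(t in `]0%R, eps])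
      (cst 1 t + counting [set j | idx L j /\ (2 * t < len L j)%R]))%E.
    apply: eq_integral => t /set_mem; rewrite /= in_itv /= => /andP[t0 _].
    exact: beta0_counting.
  rewrite ge0_integralD //; last first.
    apply: (measurable_counting
      (F := fun j => [set t | idx L j /\ 2 * t < len L j])) => j.
    exact: (@measurable_string_rel R L <%R j (fun l => mlt l)).
  have leps : lebesgue_measure `]0, eps]%classic = eps%:E.
    by rewrite lebesgue_measure_itv /= lte_fin eps_gt0 sube0.
  congr (_ + _)%E; first by rewrite integral_cst // mul1e; exact: leps.
  rewrite (@integral_counting_string R L <%R) //.
  apply: eq_eseriesr => j /set_mem Lj.
  by have [] := lebesgue_measure_halved (len0 j Lj) eps_gt0.
have -> : (\int[lebesgue_measure]_(t in `]0%R, eps])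
    geom_counting L ((2 * t)^-1)%R = S)%E.
  (* For positive [t] and positive lengths, taking inverses turns [(len L j)^-1 <= (2 * t)^-1] into
     [2 * t <= len L j]. *)
  transitivity (\int[lebesgue_measure]_(t in `]0%R, eps])
      counting [set j | idx L j /\ (2 * t <= len L j)%R])%E.
    apply: eq_integral => t /set_mem; rewrite /= in_itv /=.
    move=> /andP[t0 _]; rewrite /geom_counting; congr counting.
    apply/seteqP; split=> j [Lj h]; split=> //; move: h;
      by rewrite lef_pV2 // posrE ?mulr_gt0 // len0.
  rewrite (@integral_counting_string R L <=%R) //.
  apply: eq_eseriesr => j /set_mem Lj.
  by have [] := lebesgue_measure_halved (len0 j Lj) eps_gt0.
have E : (2%:E * (eps%:E + S) = (2 * eps)%:E + 2%:E * S)%E.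
  by rewrite ge0_muleDr ?EFinM // lee_fin ltW.
by split; rewrite E //; exact: lebesgue_measure_parallel_setD.
Qed.
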